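(* Let $R$ be a maximal subring of a ring $T$ such that $\mathrm{Char}(T)$ is not a prime number. Then either there exists a prime number $p$ such that $pT\subseteq (R:T)$ or $\mathrm{Char}(T)=\mathrm{Char}(\mathrm{End}_{\mathbb{Z}}(T/R))=0$.
   Context: All rings are associative, unital with $1\neq 0$, and not necessarily commutative; subrings contain the identity of the overring. A subring $R\subsetneq T$ is a maximal subring of $T$ if there is no subring $S$ with $R\subsetneq S\subsetneq T$. $(R:T):=\{x\in T\mid TxT\subseteq R\}$ is the largest two-sided ideal of $T$ contained in $R$. $\mathrm{Char}(S)$ is the characteristic of a ring $S$, and $\mathrm{End}_{\mathbb{Z}}(T/R)$ is the endomorphism ring of the abelian group $T/R$. *)

(* Defs.v *)
From HB Require Import structures.
From mathcomp Require Import all_boot all_order all_algebra.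
From mathcomp Require Import boolp classical_sets.

Set Implicit Arguments.
Unset Strict Implicit.
Unset Printing Implicit Defensive.

Import GRing.Theory.
Local Open Scope ring_scope.
Local Open Scope classical_set_scope.

(* [pchar S] only records a prime characteristic, hence this definition: the
   least positive n with n * 1 = 0 in S, and 0 if there is none. *)
Definition ring_char (S : pzRingType) : nat :=
  match pselect (exists n, (0 < n)%N && (n%:R == 0 :> S)) with
  | left exn => ex_minn exn
  | right _ => 0%N
  end.

Lemma dvdn_ring_char (S : pzRingType) (n : nat) :
  (ring_char S %| n)%N = (n%:R == 0 :> S).
Proof.
rewrite /ring_char; case: pselect => [exn|nex]; last first.
  rewrite dvd0n; apply/eqP/eqP => [-> //|n0].
  case: n n0 => // n n0; case: nex; exists n.+1; exact/andP/(conj _ (introT eqP n0)).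
case: ex_minnP => m /andP[m0 /eqP mS] min.
rewrite {2}(divn_eq n m) natrD natrM mS mulr0 add0r /dvdn.
apply/eqP/eqP => [->//|r0]; apply/eqP/negP => /negP.
rewrite -lt0n => rpos; have := min (n %% m)%N.
by rewrite rpos r0 eqxx leqNgt ltn_mod m0 => /(_ isT).
Qed.

Definition endo (A : zmodType) : Type := {additive A -> A}.

Section EndomorphismRing.
Variable A : zmodType.

HB.instance Definition _ := gen_eqMixin (endo A).
HB.instance Definition _ := gen_choiceMixin (endo A).

Lemma endoP (f g : endo A) : (forall x : A, f x = g x) -> f = g.
Proof.
move: f g => [f [[cf]]] [g [[cg]]] /= /funext fg; subst g.
by rewrite (Prop_irrelevance cf cg).
Qed.

Definition endo_zero : endo A := (\0 : A -> A).
Definition endo_opp (f : endo A) : endo A := \- f.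
Definition endo_add (f g : endo A) : endo A := f \+ g.
Definition endo_one : endo A := idfun.
Definition endo_mul (f g : endo A) : endo A := f \o g.

Lemma endo_addA : associative endo_add.
Proof. by move=> f g h; apply: endoP => x /=; rewrite addrA. Qed.
Lemma endo_addC : commutative endo_add.
Proof. by move=> f g; apply: endoP => x /=; rewrite addrC. Qed.
Lemma endo_add0 : left_id endo_zero endo_add.
Proof. by move=> f; apply: endoP => x /=; rewrite add0r. Qed.
Lemma endo_addN : left_inverse endo_zero endo_opp endo_add.
Proof. by move=> f; apply: endoP => x /=; rewrite addNr. Qed.

HB.instance Definition _ :=
  GRing.isZmodule.Build (endo A) endo_addA endo_addC endo_add0 endo_addN.

Lemma endo_mulA : associative endo_mul.
Proof. by move=> f g h; apply: endoP. Qed.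
Lemma endo_mul1l : left_id endo_one endo_mul.
Proof. by move=> f; apply: endoP. Qed.
Lemma endo_mul1r : right_id endo_one endo_mul.
Proof. by move=> f; apply: endoP. Qed.
Lemma endo_mulDl : left_distributive endo_mul endo_add.
Proof. by move=> f g h; apply: endoP. Qed.
Lemma endo_mulDr : right_distributive endo_mul endo_add.
Proof. by move=> f g h; apply: endoP => x /=; rewrite raddfD. Qed.

HB.instance Definition _ := GRing.Zmodule_isPzRing.Build (endo A)
  endo_mulA endo_mul1l endo_mul1r endo_mulDl endo_mulDr.

End EndomorphismRing.

Section MaximalSubring.
Variable T : nzRingType.

Definition proper_sub (A B : {pred T}) : Prop :=
  {subset A <= B} /\ ~ {subset B <= A}.

Definition maximal_subring (R : subringClosed T) : Prop :=
  proper_sub R predT /\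
  ~ exists S : subringClosed T, proper_sub R S /\ proper_sub S predT.

(* the ideal (R : T) *)
Definition conductor (R : subringClosed T) : set T :=
  [set x | forall t s : T, t * x * s \in R].

End MaximalSubring.

(* Main.v *)
Require Import Defs.
From HB Require Import structures.
From mathcomp Require Import all_boot all_order all_algebra.
From mathcomp Require Import boolp classical_sets.

Set Implicit Arguments.
Unset Strict Implicit.
Unset Printing Implicit Defensive.

Import GRing.Theory.
Local Open Scope ring_scope.
Local Open Scope classical_set_scope.

(** For every natural number [n], [n T] is a two-sided ideal of [T], so
    [R + n T] is a subring of [T] containing [R]; by maximality it is [R] or
    [T].  If [R + p T = R] for some prime [p], then the ideal [p T] lies in [R],
    hence in [(R : T)] ([multiples_sub_conductor]).  Otherwise
    [p (T / R) = T / R] for all primes [p], hence [n (T / R) = T / R] for all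
    [n > 0] ([divisible_quotient]).  A positive integer vanishing in [T] or in
    the endomorphism ring of [T / R] annihilates [T / R], which would then be
    zero, contrary to [R] being proper; so both characteristics are [0]. *)

Lemma ring_char_eq0 (S : pzRingType) :
  (forall n, (0 < n)%N -> n%:R <> 0 :> S) -> ring_char S = 0%N.
Proof.
move=> nz; apply/eqP/negPn; rewrite -lt0n; apply/negP => /nz; apply.
by apply/eqP; rewrite -dvdn_ring_char.
Qed.

Lemma endo_natE (A : zmodType) (n : nat) (x : A) :
  (n%:R : endo A) x = x *+ n.
Proof.
elim: n => [|n IHn] //.
by rewrite -[n.+1]addn1 natrD mulrnDr mulr1n -IHn.
Qed.

Section SumWithMultiples.
Variables (T : nzRingType) (R : subringClosed T) (n : nat).

(** The sum [R + n T]. *)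
Definition add_multiples : {pred T} :=
  fun t => `[< exists s : T, t - n%:R * s \in R >].

Lemma add_multiplesP (t : T) :
  reflect (exists s : T, t - n%:R * s \in R) (t \in add_multiples).
Proof. exact: asboolP. Qed.

Lemma sub_add_multiples : {subset R <= add_multiples}.
Proof. by move=> t Rt; apply/add_multiplesP; exists 0; rewrite mulr0 subr0. Qed.

Lemma multiple_in_add_multiples (t : T) : n%:R * t \in add_multiples.
Proof. by apply/add_multiplesP; exists t; rewrite subrr rpred0. Qed.

Lemma add_multiples_subring_closed : subring_closed add_multiples.
Proof.
split; first exact/sub_add_multiples/rpred1.
  move=> t u /add_multiplesP[s Rs] /add_multiplesP[v Rv].
  apply/add_multiplesP; exists (s - v).
  by rewrite mulrBr opprD addrACA -opprD rpredB.
move=> t u /add_multiplesP[s Rs] /add_multiplesP[v Rv].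
(* For t = a + n s and u = b + n v, centrality of n gives
   t u = a b + n (s u + a v). *)
apply/add_multiplesP; exists (s * u + (t - n%:R * s) * v).
have -> : t * u - n%:R * (s * u + (t - n%:R * s) * v)
          = (t - n%:R * s) * (u - n%:R * v).
  rewrite mulrDr opprD addrA mulrA -mulrBl mulrBr; congr (_ - _).
  by rewrite !mulrA (commr_nat _ n).
exact: rpredM.
Qed.

HB.instance Definition _ :=
  GRing.isSubringClosed.Build T add_multiples add_multiples_subring_closed.

End SumWithMultiples.

Lemma maximal_subring_add_multiples (T : nzRingType) (R : subringClosed T)
    (n : nat) :
  maximal_subring R ->
  (forall t : T, n%:R * t \in R) \/ (forall t : T, t \in add_multiples R n).
Proof.
move=> [_ maxR]; case: (pselect (forall t : T, n%:R * t \in R)) => [|nR].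
  by left.
right=> t; apply: contrapT => nt; apply: maxR.
exists (add_multiples R n : subringClosed T); split; split=> //.
- exact: sub_add_multiples.
- by move=> sR; apply: nR => u; exact/sR/multiple_in_add_multiples.
- by move=> sS; apply: nt; exact: sS.
Qed.

Lemma multiples_sub_conductor (T : nzRingType) (R : subringClosed T) (n : nat) :
  (forall t : T, n%:R * t \in R) ->
  [set n%:R * t | t in [set: T]] `<=` conductor R.
Proof.
move=> nR _ [t _ <-] a b.
by rewrite (mulrA a) (commr_nat a n) -!mulrA.
Qed.

(** Divisibility of [T / R] by all primes gives divisibility by all positive
    integers. *)
Lemma divisible_quotient (T : nzRingType) (R : subringClosed T) :
  (forall p, prime p -> forall t : T, t \in add_multiples R p) ->
  forall n, (0 < n)%N -> forall t : T, t \in add_multiples R n.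
Proof.
move=> divR; elim/ltn_ind => n IHn n0 t.
have [n_le1|n1] := leqP n 1.
  have -> : n = 1%N by apply/eqP; rewrite eqn_leq n_le1.
  by rewrite -[t]mul1r; exact: (multiple_in_add_multiples R 1).
have [p p_pr /dvdnP[m n_mp]] := pdivP n1.
have m0 : (0 < m)%N by move: n0; rewrite n_mp muln_gt0 => /andP[].
have m_lt : (m < n)%N by rewrite n_mp ltn_Pmulr ?prime_gt1.
have /add_multiplesP[s Rs] := divR p p_pr t.
have /add_multiplesP[u Ru] := IHn _ m_lt m0 s.
apply/add_multiplesP; exists u.
have -> : t - n%:R * u = (t - p%:R * s) + p%:R * (s - m%:R * u).
  by rewrite n_mp mulnC natrM mulrBr mulrA addrA subrK.
by rewrite rpredD ?rpredM ?rpred_nat.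
Qed.

Theorem corollary2p20 (T : nzRingType) (R : subringClosed T)
    (maxR : maximal_subring R) (charT : ~~ prime (ring_char T)) :
  (exists p : nat, prime p /\
     [set p%:R * t | t in [set: T]] `<=` conductor R) \/
  (ring_char T = 0%N /\ ring_char (endo (Quotient.quot R)) = 0%N).
Proof.
case: (pselect (exists p, prime p /\ forall t : T, p%:R * t \in R)).
  move=> [p [p_pr pR]]; left; exists p.
  by split=> //; exact: multiples_sub_conductor.
move=> noprime; right.
have divR : forall n, (0 < n)%N -> forall t : T, t \in add_multiples R n.
  apply: divisible_quotient => p p_pr.
  case: (maximal_subring_add_multiples p maxR) => // pR.
  by case: noprime; exists p.
have not_annihilated n : (0 < n)%N -> ~ (forall t : T, n%:R * t \in R).
  move=> n0 nR; case: maxR => -[_ properR] _; apply: properR => t _.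
  have /add_multiplesP[s Rs] := divR n n0 t.
  by rewrite -[t](subrK (n%:R * s)) rpredD.
split; apply: ring_char_eq0 => n n0 nE; apply: (not_annihilated n n0) => t.
  by rewrite nE mul0r rpred0.
have : (t *+ n = 0 %[mod Quotient.quot R])%qT.
  by rewrite !raddfMn raddf0 -endo_natE nE.
by move/eqP; rewrite -Quotient.idealrBE subr0 mulr_natl.
Qed.
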